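(* Let $S$ be a closable linear operator acting on a Hilbert space $\mathcal{H}$. The following statements are equivalent: (i) $S$ is essentially selfadjoint; (ii) (a) $S\wedge S$; (b) $(\operatorname{ran}S)^\perp=\ker\bar S$; (c) $R_S=\operatorname{ran}\bar S$.
   Context: Hilbert spaces are real or complex. A linear operator $S$ on $\mathcal{H}$ is a linear map $S:\operatorname{dom}S\to\mathcal{H}$ defined on a linear subspace $\operatorname{dom}S\subseteq\mathcal{H}$; it is not assumed bounded, closed or densely defined. $S$ is closable if the closure of its graph is the graph of an operator, denoted $\bar S$. The adjoint $S^*$ of a densely defined $S$ has domain $\{k:\exists h'\ \forall h\in\operatorname{dom}S,\ \langle Sh,k\rangle=\langle h,h'\rangle\}$ and $S^*k:=h'$. An operator is selfadjoint if it is densely defined and equals its adjoint (with equal domains). $S$ is essentially selfadjoint if it is densely defined, closable, and $\bar S$ is selfadjoint. $S\wedge S$ means $\langle Sh,k\rangle=\langle h,Sk\rangle$ for all $h,k\in\operatorname{dom}S$. $R_S:=\{h\in\mathcal{H}:\sup\{|\langle h,h'\rangle|:h'\in\operatorname{dom}S,\ \|Sh'\|\le1\}<\infty\}$. *)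

(* Defs.v *)
From HB Require Import structures.
From mathcomp Require Import all_boot all_order all_algebra complex.
From mathcomp Require Import all_classical all_reals all_analysis.

Set Implicit Arguments.
Unset Strict Implicit.
Unset Printing Implicit Defensive.

Import Order.TTheory GRing.Theory Num.Theory.
Import numFieldNormedType.Exports.

Local Open Scope classical_set_scope.
Local Open Scope ring_scope.

Variant scalar_kind := RealScalars | ComplexScalars.

Definition scalar_field (R : realType) (k : scalar_kind) : numFieldType :=
  match k with
  | RealScalars => R
  | ComplexScalars => R[i]
  end.

Definition scalar_conj (R : realType) (k : scalar_kind) :
    {rmorphism scalar_field R k -> scalar_field R k} :=
  match k return {rmorphism scalar_field R k -> scalar_field R k} with
  | RealScalars => idfun
  | ComplexScalars => Num.conj
  end.

(* A Hilbert space is a complete normed module H over [scalar_field R k] together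
   with an [inner_product H]: a positive definite Hermitian form, linear in its
   first argument, which induces the norm of H. *)
Record inner_product (R : realType) (k : scalar_kind)
    (H : completeNormedModType (scalar_field R k)) := InnerProduct {
  inner :> {dot H for scalar_conj R k} ;
  norm_inner : forall x : H, `|x| ^+ 2 = inner x x
}.

(* The values of [op_fun] outside [op_dom] carry no information: operators are
   only ever compared through [op_eq] or through their graphs. *)
Record linop (K : numFieldType) (H : lmodType K) := LinOp {
  op_dom : set H ;
  op_fun :> H -> H ;
  op_dom0 : op_dom 0 ;
  op_dom_linear : forall (a : K) (x y : H), op_dom x -> op_dom y -> op_dom (a *: x + y) ;
  op_linear : forall (a : K) (x y : H), op_dom x -> op_dom y ->
    op_fun (a *: x + y) = a *: op_fun x + op_fun y
}.

Section Operators.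
Variables (K : numFieldType) (H : normedModType K).
Implicit Types S T : linop H.

Definition op_eq S T := op_dom S = op_dom T /\ forall x, op_dom S x -> S x = T x.

Definition op_graph S : set (H * H) := [set (x, S x) | x in op_dom S].

Definition op_ran S : set H := [set S x | x in op_dom S].

Definition op_ker S : set H := [set x | op_dom S x /\ S x = 0].

Definition densely_defined S := dense (op_dom S).

Definition closable S := exists T, op_graph T = closure (op_graph S).

Definition op_closure S (clS : closable S) : linop H := sval (cid clS).

End Operators.

Section InnerProductOperators.
Variables (R : realType) (k : scalar_kind).
Variables (H : completeNormedModType (scalar_field R k)) (ip : inner_product H).
Implicit Types S T : linop H.

Definition ortho_compl (A : set H) : set H :=
  [set x | forall y, A y -> ip y x = 0].

Definition adjoint_rel S (x x' : H) :=
  forall y, op_dom S y -> ip (S y) x = ip y x'.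

Lemma dense_inner_inj (D : set H) : dense D -> forall x y : H,
  (forall z, D z -> ip z x = ip z y) -> x = y.
Proof.
move=> dD x y xy; apply/eqP; rewrite -subr_eq0; apply/negPn/negP => d0.
set d := x - y in d0; have nd : 0 < `|d| by rewrite normr_gt0.
have [] := dD (ball d `|d|) _ (ball_open d _); first by exists d; exact: ballxx.
move=> z [+ Dz]; rewrite -ball_normE /= => dz.
have zd : ip d z = 0.
  by rewrite hermC linearB /= (xy _ Dz) subrr rmorph0 mulr0.
have : `|d| ^+ 2 <= `|d - z| ^+ 2.
  rewrite !(norm_inner ip) (hnormBd zd).
  have zz : 0 <= ip z z by rewrite -norm_inner exprn_ge0.
  by rewrite lerDl; exact: zz.
rewrite ler_pXn2r ?nnegrE // => dle.
by have := le_lt_trans dle dz; rewrite ltxx.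
Qed.

Section Adjoint.
Variables (S : linop H) (dS : densely_defined S).

Let adj_dom : set H := [set x | exists x', adjoint_rel S x x'].
Let adj_fun (x : H) : H := xget 0 [set x' | adjoint_rel S x x'].

Let adj_funP x : adj_dom x -> adjoint_rel S x (adj_fun x).
Proof. by move=> [x' Sx]; rewrite /adj_fun; case: xgetP => [y _ //|/(_ x')]. Qed.

Let adjoint_rel_linear a x y x' y' : adjoint_rel S x x' ->
  adjoint_rel S y y' -> adjoint_rel S (a *: x + y) (a *: x' + y').
Proof. by move=> Sx Sy z Dz; rewrite !linearPr /= (Sx _ Dz) (Sy _ Dz). Qed.

Let adj_dom0 : adj_dom 0.
Proof. by exists 0 => y _; rewrite !linear0r. Qed.

Let adj_dom_linear a x y : adj_dom x -> adj_dom y -> adj_dom (a *: x + y).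
Proof.
by move=> [x' Sx] [y' Sy]; exists (a *: x' + y'); exact: adjoint_rel_linear.
Qed.

Let adj_fun_linear a x y : adj_dom x -> adj_dom y ->
  adj_fun (a *: x + y) = a *: adj_fun x + adj_fun y.
Proof.
move=> Dx Dy; apply: (dense_inner_inj dS) => z Dz.
rewrite -(adj_funP (adj_dom_linear a Dx Dy) Dz).
exact: (adjoint_rel_linear a (adj_funP Dx) (adj_funP Dy)).
Qed.

Definition adjoint : linop H := LinOp adj_dom0 adj_dom_linear adj_fun_linear.

Lemma adjointP x : op_dom adjoint x -> adjoint_rel S x (adjoint x).
Proof. exact: adj_funP. Qed.

End Adjoint.

Definition selfadjoint S :=
  exists dS : densely_defined S, op_eq S (adjoint dS).

Definition essentially_selfadjoint S :=
  densely_defined S /\ exists clS : closable S, selfadjoint (op_closure clS).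

Definition formally_adjoint S T :=
  forall x y, op_dom S x -> op_dom T y -> ip (S x) y = ip x (T y).

(* For complex scalars [`|ip x y|] is a nonnegative real element of [R[i]], and
   an upper bound of such elements is necessarily real as well. *)
Definition Rset S : set H :=
  [set x | has_ubound [set `|ip x y| | y in [set y | op_dom S y /\ `|S y| <= 1]]].

End InnerProductOperators.

(* Main.v *)
Require Import Defs.
From mathcomp Require Import all_boot all_order all_algebra.
From mathcomp Require Import complex ring.
From mathcomp Require Import all_classical all_reals all_analysis.

(** The statement is about the relation [adjoint_rel ip S x x'], which makes
    sense without density: for every [u] in the domain, the pairing of [S u]
    with [x] is that of [u] with [x'].  Write [T] for the closure of [S].  By
    continuity [S] and [T] have the same adjoint relation
    ([adjoint_rel_closure]), so essential selfadjointness says that [S] is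
    densely defined and that the adjoint relation of [S] is the graph of [T]
    ([essentially_selfadjointE]).

    Conditions (b) and (c) speak of the same relation: the orthogonal
    complement of the range is the set of [x] related to [0] ([ortho_ranE]),
    and [Rset] is the set of all second components ([Rset_adjointE]).  Given
    essential selfadjointness, (a), (b) and (c) are therefore read off the graph
    of [T].  Conversely, suppose (a), (b) and (c).
    - If [z] is orthogonal to the domain of [S], then [0] is related to [z], so
      [z = T y] by (c).  By (a), [y] is related to [T y = z], and since [z] is
      orthogonal to the domain, [y] is also related to [0]; hence [T y = 0] by
      (b), and [z = 0].  Thus [S] is densely defined ([dense_of_ortho]).
    - If [x] is related to [x'], then [x' = T y] by (c), [y] is related to [x']
      by (a), so [x - y] is related to [0] and lies in the kernel of [T] by (b).
      Hence [T x = T y = x'].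

    The only analytic input is [riesz_factor], a form of the Riesz
    representation theorem: if [u |-> ip u h] is bounded by a multiple of
    [`|S u|], it factors through the range of [S] as [u |-> ip (S u) z] with [z]
    in the closure of that range.  It yields [Rset_adjointE], and, for the
    inclusion of a subspace in the place of [S], it yields [dense_of_ortho]
    without a projection theorem.  The vector [z] is the limit of [S u] along
    approximate minimizers of the quadratic functional [energy S h u], which is
    [`|S u| ^+ 2 - 2 Re (ip u h)]. *)

Set Implicit Arguments.
Unset Strict Implicit.
Unset Printing Implicit Defensive.

Import Order.TTheory GRing.Theory Num.Theory.
Import numFieldNormedType.Exports.

Local Open Scope classical_set_scope.
Local Open Scope ring_scope.

(** * Real and complex scalars *)

Section Scalars.
Variables (R : realType) (k : scalar_kind).
Local Notation K := (scalar_field R k).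
Local Notation "c ^#" := (scalar_conj R k c) (at level 2).

Lemma scalar_conjK (c : K) : (c^#)^# = c.
Proof. by case: k c => c //; exact: conjCK. Qed.

Lemma scalar_normCK (c : K) : c * c^# = `|c| ^+ 2.
Proof. by case: k c => c; [exact/esym/real_normK/num_real|exact/esym/normCK]. Qed.

Lemma norm_scalar_conj (c : K) : `|c^#| = `|c|.
Proof. by case: k c => c //; exact: norm_conjC. Qed.

Lemma scalar_conj_real (c : K) : c \is Num.real -> c^# = c.
Proof. by case: k c => c //; exact: CrealP. Qed.

Lemma scalar_addconj_real (c : K) : c + c^# \is Num.real.
Proof.
case: k c => c; first exact: num_real.
by apply/CrealP; rewrite rmorphD /= conjCK addrC.
Qed.

Lemma scalar_archi (x : K) : 0 <= x -> exists n : nat, x < n%:R.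
Proof.
case: k x => x x0.
  by exists (Num.bound x); exact: archi_boundP.
move: (x0 : 0 <= x :> R[i]); case: x x0 => a b _ ; rewrite lecE /= => /andP[/eqP b0 a0].
exists (Num.bound a).
have -> : ((Num.bound a)%:R : R[i]) = ((Num.bound a)%:R : R)%:C%C by rewrite rmorph_nat.
by move: (archi_boundP a0) => h; rewrite /= ltcE /= b0 eqxx.
Qed.

(** The scalars need not be totally ordered, so infima are avoided: without a
    minimizer up to [e], one could decrease [J] by [e] indefinitely, against the
    archimedean property. *)
Lemma near_minimizer (X : Type) (D : set X) (J : X -> K) (x0 : X) (b e : K) :
  D x0 -> (forall x, D x -> J x \is Num.real) -> (forall x, D x -> b <= J x) ->
  0 < e -> exists2 x, D x & forall y, D y -> J x <= J y + e.
Proof.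
move=> Dx0 Jreal bJ e0; apply: contrapT => noM.
have descend n : exists2 x, D x & J x <= J x0 - n%:R * e.
  elim: n => [|n [x Dx Jx]]; first by exists x0; rewrite // mul0r subr0.
  have [y Dy Jy] : exists2 y, D y & J y + e < J x.
    apply: contrapT => noy; apply: noM; exists x => // y Dy.
    rewrite real_leNgt ?realD ?Jreal ?gtr0_real //.
    by apply/negP => Jyx; apply: noy; exists y.
  exists y => //.
  rewrite -natr1 mulrDl mul1r opprD addrA lerBrDr.
  exact: le_trans (ltW Jy) Jx.
have [n bn] : exists n : nat, (J x0 - b) / e < n%:R.
  by apply: scalar_archi; rewrite divr_ge0 ?subr_ge0 ?bJ ?ltW.
have [x Dx Jx] := descend n.
have : b <= J x0 - n%:R * e by exact: le_trans (bJ _ Dx) Jx.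
rewrite lerBrDr -lerBrDl -ler_pdivlMr // => nb.
by have := lt_le_trans bn nb; rewrite ltxx.
Qed.

Lemma eq0_le_eps (a C : K) : 0 <= C -> (forall e, 0 < e -> `|a| <= e * C) -> a = 0.
Proof.
move=> C0 aC; apply/eqP; rewrite -normr_le0.
have C1 : 0 < C + 1 by rewrite ltr_wpDl.
have [//|a0] := eqVneq a 0; first by move=> ->; rewrite normr0.
have := aC (`|a| / (C + 1)); rewrite divr_gt0 ?normr_gt0 // => /(_ isT).
rewrite mulrAC ler_pdivlMr // ler_pM2l ?normr_gt0 //.
by rewrite gerDl ler10.
Qed.

End Scalars.
(** * Inner products and operators *)

Section InnerProduct.
Variables (R : realType) (k : scalar_kind).
Local Notation K := (scalar_field R k).
Local Notation "c ^#" := (scalar_conj R k c) (at level 2).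
Variables (H : completeNormedModType K) (ip : inner_product H).
Implicit Types S T : linop H.

Lemma innerC x y : ip x y = (ip y x)^#.
Proof. by rewrite hermC expr0 mul1r. Qed.

Lemma norm_innerC x y : `|ip x y| = `|ip y x|.
Proof. by rewrite innerC norm_scalar_conj. Qed.

Lemma innerZl a x y : ip (a *: x) y = a * ip x y.
Proof. by rewrite linearZl_LR. Qed.

Lemma innerZr a x y : ip x (a *: y) = a^# * ip x y.
Proof. by rewrite linearZr_LR. Qed.

Lemma norm_innerZD (a : K) x y : `|a *: x + y| ^+ 2 =
  `|a| ^+ 2 * `|x| ^+ 2 + (a * ip x y + (a * ip x y)^#) + `|y| ^+ 2.
Proof.
rewrite [LHS](norm_inner ip) (norm_inner ip x) (norm_inner ip y).
rewrite linearDl !linearDr /= !innerZl !innerZr (innerC y x) rmorphM /=.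
by rewrite -scalar_normCK; ring.
Qed.

(** The usual argument: [x] minus its projection on [y] has a nonnegative
    squared norm. *)
Lemma inner_CauchySchwarz x y : `|ip x y| <= `|x| * `|y|.
Proof.
have [->|y0] := eqVneq y 0; first by rewrite linear0r !normr0 mulr0.
have ny : 0 < `|y| by rewrite normr_gt0.
rewrite -(@ler_pXn2r _ 2) ?nnegrE ?mulr_ge0 // exprMn.
have := exprn_ge0 2 (normr_ge0 (- (ip x y / `|y| ^+ 2) *: y + x)).
have : 0 < `|y| ^+ 2 by rewrite exprn_gt0.
rewrite norm_innerZD; move: (`|y| ^+ 2) => q q0.
have qq : q^# = q by rewrite scalar_conj_real ?gtr0_real.
rewrite -scalar_normCK (innerC y x) !(rmorphN, rmorphM, fmorphV) /= qq.
rewrite !scalar_conjK -(scalar_normCK (ip x y)) => h0.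
rewrite -ler_pdivrMr // -subr_ge0; apply: le_trans h0 _.
rewrite le_eqVlt; apply/orP; left; apply/eqP.
(* The identity is checked over an abstract field, where [field] is fast. *)
move: q q0 {qq} (ip x y) (_^#) (`|x| ^+ 2).
suff id (F : fieldType) (q c d p : F) : q != 0 ->
    - (c / q) * - (d / q) * q + (- (c / q) * d + - (d / q) * c) + p = p - c * d / q.
  by move=> q q0 c d p; apply: id; rewrite gt_eqF.
by move=> q0; field.
Qed.

Lemma op_domZ S a x : op_dom S x -> op_dom S (a *: x).
Proof. by move=> Dx; rewrite -[_ *: _]addr0; apply: op_dom_linear Dx (op_dom0 S). Qed.

Lemma op_fun0 S : S 0 = 0.
Proof.
have := op_linear (-1) (op_dom0 S) (op_dom0 S).
by rewrite scaler0 addr0 scaleN1r addNr.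
Qed.

Lemma op_funZ S a x : op_dom S x -> S (a *: x) = a *: S x.
Proof.
move=> Dx; rewrite -[a *: x]addr0 op_linear //; last exact: op_dom0.
by rewrite op_fun0 addr0.
Qed.

Lemma exists_lower (a b : K) : 0 < a -> 0 < b ->
  exists e, [/\ 0 < e, e <= a & e <= b].
Proof.
move=> a0 b0; have [ab|ba] := real_leP (gtr0_real a0) (gtr0_real b0).
  by exists a; split.
by exists b; split => //; exact: ltW.
Qed.

(** * A Riesz representation through the range of an operator *)

(** The sum of a scalar and its conjugate stands for twice the real part, for
    both kinds of scalars. *)
Definition energy S h u : K := `|S u| ^+ 2 - (ip u h + (ip u h)^#).

Definition near_min S h e u :=
  op_dom S u /\ forall v, op_dom S v -> energy S h u <= energy S h v + e.

Lemma energy_real S h u : energy S h u \is Num.real.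
Proof. by rewrite realB ?scalar_addconj_real ?realX. Qed.

(** Up to the linear term, which is at most [2 * M * `|S u|], the energy is a
    square; completing the square gives the bound. *)
Lemma energy_lbound S h M u : 0 <= M -> `|ip u h| <= M * `|S u| ->
  - M ^+ 2 <= energy S h u.
Proof.
move=> M0 hM; have le2 : ip u h + (ip u h)^# <= M * `|S u| *+ 2.
  apply: le_trans (real_ler_norm (scalar_addconj_real _)) _.
  rewrite (le_trans (ler_normD _ _)) // norm_scalar_conj -mulr2n.
  by rewrite lerMn2r hM.
rewrite -subr_ge0 opprK; apply: (@le_trans _ _ ((`|S u| - M) ^+ 2)).
  by rewrite real_exprn_even_ge0 // realB // ger0_real.
by rewrite /energy sqrrB lerD2r lerD2l lerN2 mulrC.
Qed.

Lemma energyZD S h t u v : op_dom S u -> op_dom S v ->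
  let c := ip (S v) (S u) - ip v h in
  energy S h (t *: v + u) =
    energy S h u + (t * c + (t * c)^#) + `|t| ^+ 2 * `|S v| ^+ 2.
Proof.
move=> Du Dv c; rewrite /energy op_linear // norm_innerZD linearDl /= innerZl.
by rewrite /c !(rmorphD, rmorphB, rmorphM) /=; ring.
Qed.

Lemma near_minW S h e e' u : e <= e' -> near_min S h e u -> near_min S h e' u.
Proof.
by move=> ee [Du uJ]; split=> // v Dv; rewrite (le_trans (uJ _ Dv)) // lerD2l.
Qed.

(** Parallelogram identity: the energy of the midpoint of [u] and [v] is below
    the mean of their energies by a quarter of [`|S u - S v| ^+ 2], and it cannot
    be below it by more than [e]. *)
Lemma near_min_close S h e u v : near_min S h e u -> near_min S h e v ->
  `|S u - S v| ^+ 2 <= e *+ 4.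
Proof.
move=> [Du uJ] [Dv vJ].
have Dd : op_dom S ((-1) *: v + u) by exact: op_dom_linear.
have Sd : S ((-1) *: v + u) = S u - S v by rewrite op_linear // scaleN1r addrC.
set d := (-1) *: v + u in Dd Sd.
have ud : u = 1 *: d + v by rewrite scale1r /d scaleN1r addrAC addNr add0r.
have Dm : op_dom S (2^-1 *: d + v) by exact: op_dom_linear.
have h2 : `|2^-1 : K| = 2^-1 by rewrite ger0_norm.
have := lerD (uJ _ Dm) (vJ _ Dm); rewrite {1}ud !(energyZD h _ Dv Dd) Sd.
rewrite h2 normr1 !rmorphM rmorph1 (fmorphV _ 2) rmorph_nat /=.
set c := _ - _; set q := `|_| ^+ 2.
rewrite -subr_ge0 => h0; rewrite -subr_ge0.
(* Here [j] is the energy of [v], [b + b'] the first variation in the direction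
   [d], and [p] the square of the norm of [S d]. *)
have mid (F : numFieldType) (j b b' p r : F) :
    2 * (j + (2^-1 * b + 2^-1 * b') + 2^-1 ^+ 2 * p + r +
         (j + (2^-1 * b + 2^-1 * b') + 2^-1 ^+ 2 * p + r) -
         (j + (1 * b + 1 * b') + 1 ^+ 2 * p + j)) = r *+ 4 - p.
  by field.
by rewrite -(mid _ (energy S h v) c c^#) mulr_ge0.
Qed.

(** Approximate Euler equation: [c = ip (S v) (S u) - ip v h] is the first
    variation of the energy at [u] in the direction [v], and moving [u] along
    [v] by the best multiple of [c^#] cannot lower the energy by more than [e]. *)
Lemma near_min_euler S h e u v : near_min S h e u -> op_dom S v ->
  `|ip (S v) (S u) - ip v h| ^+ 2 <= e * (`|S v| ^+ 2 + 1).
Proof.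
move=> [Du uJ] Dv; set c := _ - _.
set q := `|S v| ^+ 2; have q1 : 0 < q + 1 by rewrite ltr_wpDl ?exprn_ge0.
(* The optimal step is [q^-1]; adding [1] covers the case [S v = 0]. *)
pose s := (q + 1)^-1; have s0 : 0 < s by rewrite invr_gt0.
have Dt : op_dom S ((- s * c^#) *: v + u) by exact: op_dom_linear.
have sr : s^# = s by rewrite scalar_conj_real // gtr0_real.
have := uJ _ Dt; rewrite energyZD // -/c -/q.
rewrite -(scalar_normCK (- s * _)) !(rmorphN, rmorphM) /= !sr !scalar_conjK.
rewrite -subr_ge0 => h0.
(* The change of energy for this step, with [b * b'] for [`|c| ^+ 2] and [r]
   for the tolerance [e]. *)
have opt (F : fieldType) (j b b' p r : F) : p + 1 != 0 ->
    j + (- (p + 1)^-1 * b' * b + - (p + 1)^-1 * b * b') +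
      - (p + 1)^-1 * b' * (- (p + 1)^-1 * b) * p + r - j =
    r - b * b' / (p + 1) - b * b' * (p + 1)^-1 ^+ 2.
  by move=> p0; field.
rewrite opt ?gt_eqF // subr_ge0 in h0.
rewrite -ler_pdivrMr // -subr_ge0 -(scalar_normCK c); apply: le_trans _ h0.
by rewrite scalar_normCK mulr_ge0 ?exprn_ge0 // ltW.
Qed.

(** The images under [S] of the approximate minimizers of the energy form a
    Cauchy filter ([near_min_close]); in the limit, the approximate Euler
    equation ([near_min_euler]) becomes exact. *)
Lemma riesz_factor S h M : 0 <= M ->
  (forall u, op_dom S u -> `|ip u h| <= M * `|S u|) ->
  exists2 z, adjoint_rel ip S z h &
    forall e, 0 < e -> exists2 u, op_dom S u & `|z - S u| < e.
Proof.
move=> M0 hM.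
have nearminE e : 0 < e -> exists u, near_min S h e u.
  move=> e0; have [u Du uJ] := near_minimizer (op_dom0 S)
    (fun u _ => energy_real S h u) (fun u Du => energy_lbound M0 (hM u Du)) e0.
  by exists u.
pose F := filter_from [set e : K | 0 < e] (fun e => S @` near_min S h e).
have FF : ProperFilter F.
  apply: filter_from_proper; last first.
    by move=> e /= /nearminE[u uJ]; exists (S u), u.
  apply: filter_from_filter; first by exists 1 => /=.
  move=> e e' /= e0 e'0; have [d [d0 de de']] := exists_lower e0 e'0.
  by exists d => // _ [u ud <-]; split; exists u => //; apply: near_minW ud.
have : cvg F.
  apply: cauchy_cvg; apply: cauchy_exP => e e0.
  pose d := e ^+ 2 / 8; have d0 : 0 < d by rewrite divr_gt0 ?exprn_gt0.
  have [u ud] := nearminE _ d0; exists (S u); exists d => //= _ [v vd <-].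
  rewrite -ball_normE /= -(@ltr_pXn2r _ 2) ?nnegrE // ?ltW //.
  apply: le_lt_trans (near_min_close ud vd) _.
  rewrite /d -mulrnAr gtr_pMr ?exprn_gt0 // -mulr_natl ltr_pdivrMr // mul1r.
  by rewrite ltr_nat.
set z := lim F => Fz.
have approx e : 0 < e -> exists2 u, near_min S h e u & `|z - S u| < e.
  move=> e0; have [d /= d0 dz] : F (ball z e) by apply: Fz; exact: nbhsx_ballx.
  have [d' [d'0 dd' de]] := exists_lower d0 e0.
  have [u ud] := nearminE _ d'0; exists u; first exact: near_minW ud.
  have : ball z e (S u) by apply: dz; exists u => //; exact: near_minW ud.
  by rewrite -ball_normE.
exists z; last by move=> e /approx[u [Du _] zu]; exists u.
move=> v Dv; apply/eqP; rewrite -subr_eq0; apply/eqP.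
apply: (@eq0_le_eps _ _ _ (`|S v| + (`|S v| ^+ 2 + 1))).
  by rewrite !addr_ge0 ?exprn_ge0.
move=> e e0; have e2 : 0 < e ^+ 2 by rewrite exprn_gt0.
have [d [d0 de de2]] := exists_lower e0 e2.
have [u ud zu] := approx _ d0.
have -> : ip (S v) z - ip v h = ip (S v) (z - S u) + (ip (S v) (S u) - ip v h).
  by rewrite linearBr /=; ring.
rewrite (le_trans (ler_normD _ _)) // mulrDr lerD //.
  rewrite (le_trans (inner_CauchySchwarz _ _)) // mulrC ler_wpM2r //.
  exact: le_trans (ltW zu) de.
set q := `|S v| ^+ 2; have q1 : 1 <= q + 1 by rewrite lerDr exprn_ge0.
have q0 : 0 <= q + 1 by exact: le_trans ler01 q1.
rewrite -(@ler_pXn2r _ 2) ?nnegrE // ?(mulr_ge0 (ltW e0)) //.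
apply: le_trans (near_min_euler ud Dv) _; rewrite -/q exprMn.
apply: ler_pM => //; first exact: ltW.
by rewrite expr2 ler_peMl.
Qed.

Lemma adjoint_relD S a x x' y y' : adjoint_rel ip S x x' -> adjoint_rel ip S y y' ->
  adjoint_rel ip S (a *: x + y) (a *: x' + y').
Proof.
by move=> Sx Sy u Du; rewrite !linearDr /= !innerZr Sx // Sy.
Qed.

(** * Range, density and [Rset] in terms of the adjoint relation *)

Lemma ortho_ranE S x : ortho_compl ip (op_ran S) x <-> adjoint_rel ip S x 0.
Proof.
split=> [Sx u Du|Sx _ [u Du <-]]; first by rewrite linear0r; apply: Sx; exists u.
by rewrite Sx // linear0r.
Qed.

(** [riesz_factor] for the inclusion of the domain represents [h], as a functional
    on the domain, by a vector [z] of the closure of the domain.  As [h - z] is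
    orthogonal to the domain, [h] is [z]. *)
Lemma dense_of_ortho S :
  (forall z, ortho_compl ip (op_dom S) z -> z = 0) -> densely_defined S.
Proof.
move=> S0 O [h Oh] Oopen.
pose I := @LinOp _ _ (op_dom S) id (op_dom0 S) (@op_dom_linear _ _ S)
  (fun _ _ _ _ _ => erefl).
have [|z zh zD] := @riesz_factor I h `|h| (normr_ge0 _).
  by move=> u _; rewrite mulrC inner_CauchySchwarz.
have /S0/eqP : ortho_compl ip (op_dom S) (h - z).
  by move=> u Du; rewrite linearBr /= -(zh u Du) subrr.
rewrite subr_eq0 => /eqP hz.
have /nbhs_ballP[e /= e0 eO] : nbhs h O by exact: open_nbhs_nbhs.
have [u Du zu] := zD _ e0; exists u; split=> //; apply: eO.
by rewrite -ball_normE /= hz.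
Qed.

(** By homogeneity, membership in [Rset] means that the pairing of [u] with [x]
    is bounded by a multiple of [`|S u|]. *)
Lemma Rset_adjointE S x : Rset ip S x <-> exists y, adjoint_rel ip S y x.
Proof.
split=> [[M ubM]|[y Sy]]; last first.
  exists `|y| => _ [u [Du Su] <-]; rewrite norm_innerC -Sy //.
  rewrite (le_trans (inner_CauchySchwarz _ _)) //.
  by rewrite -[leRHS]mul1r ler_wpM2r.
have bound t u : op_dom S u -> `|S (t *: u)| <= 1 -> `|t| * `|ip u x| <= M.
  move=> Du tu; rewrite -normrM -innerZl norm_innerC.
  by apply: ubM; exists (t *: u) => //; split => //; exact: op_domZ.
have M0 : 0 <= M.
  have := bound 0 0 (op_dom0 S); rewrite scale0r op_fun0 !normr0 mul0r.
  by apply; exact: ler01.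
have [|y Sy _] := @riesz_factor S x M M0; last by exists y.
(* Normalizing [u] by [`|S u|] gives the bound, unless [S u = 0], in which case
   arbitrarily large multiples of [u] are allowed. *)
move=> u Du; have [Su0|Su0] := eqVneq (S u) 0.
  suff -> : ip u x = 0 by rewrite normr0 mulr_ge0.
  apply: (eq0_le_eps M0) => e e0.
  have := bound e^-1 u Du; rewrite op_funZ // Su0 scaler0 normr0 => /(_ ler01).
  have -> : `|e^-1| = e^-1 by rewrite gtr0_norm ?invr_gt0.
  by rewrite ler_pdivrMl.
have nSu : 0 < `|S u| by rewrite normr_gt0.
have := bound `|S u|^-1 u Du; rewrite op_funZ // normrZ normfV normr_id.
by rewrite mulVf ?gt_eqF // => /(_ (lexx _)); rewrite ler_pdivrMl // mulrC.
Qed.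

(** * The closure *)

Section Closure.
Variables (S : linop H) (clS : closable S).
Local Notation T := (op_closure clS).

Lemma op_closure_graph : op_graph T = closure (op_graph S).
Proof. exact: svalP (cid clS). Qed.

Lemma op_closure_sub x : op_dom S x -> op_dom T x /\ T x = S x.
Proof.
move=> Dx; have : op_graph T (x, S x).
  by rewrite op_closure_graph; apply: subset_closure; exists x.
by move=> [y Ty [<- <-]].
Qed.

Lemma op_closure_approx x e : op_dom T x -> 0 < e ->
  exists u, [/\ op_dom S u, `|x - u| < e & `|T x - S u| < e].
Proof.
move=> Tx e0; have : closure (op_graph S) (x, T x).
  by rewrite -op_closure_graph; exists x.
move=> /(_ _ (nbhsx_ballx _ _ e0))[_ [[u Du <-]]].
by case; rewrite -!ball_normE /= => xu Txu; exists u.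
Qed.

(** The relation is a continuous condition on the graph of the operator. *)
Lemma adjoint_rel_closure x x' : adjoint_rel ip T x x' <-> adjoint_rel ip S x x'.
Proof.
split=> [Tx u Du|Sx y Ty].
  by have [Tu <-] := op_closure_sub Du; exact: Tx.
apply/eqP; rewrite -subr_eq0; apply/eqP.
apply: (@eq0_le_eps _ _ _ (`|x| + `|x'|)); first by rewrite addr_ge0.
move=> e e0; have [u [Du yu Tyu]] := op_closure_approx Ty e0.
have -> : ip (T y) x - ip y x' = ip (T y - S u) x - ip (y - u) x'.
  by rewrite !linearBl /= (Sx u Du); ring.
rewrite (le_trans (ler_normB _ _)) // mulrDr lerD //.
  by rewrite (le_trans (inner_CauchySchwarz _ _)) // ler_wpM2r // ltW.
by rewrite (le_trans (inner_CauchySchwarz _ _)) // ler_wpM2r // ltW.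
Qed.

(** Symmetry of [S] makes each [u] in its domain related to [S u]; this
    relation tests [T] as well, and conjugation exchanges the two sides. *)
Lemma adjoint_rel_symmetric x : formally_adjoint ip S S ->
  op_dom T x -> adjoint_rel ip S x (T x).
Proof.
move=> Ssym Tx u Du.
have Su : adjoint_rel ip T u (S u) by apply/adjoint_rel_closure => v Dv; exact: Ssym.
by rewrite innerC -Su // -innerC.
Qed.

(** Density makes [x'] unique, so that [adjoint] is the function with graph
    [adjoint_rel]. *)
Lemma essentially_selfadjointE : essentially_selfadjoint ip S <->
  densely_defined S /\
  forall x x', adjoint_rel ip S x x' <-> op_dom T x /\ T x = x'.
Proof.
split=> [[dS [clS' [dT [domT funT]]]]|[dS graphT]].
  rewrite (Prop_irrelevance clS' clS) in dT domT funT.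
  have TT x : op_dom T x -> adjoint_rel ip T x (T x).
    by move=> Tx; rewrite funT //; apply: adjointP; rewrite -domT.
  split=> // x x'; rewrite -adjoint_rel_closure; split=> [Tx|[Tx <-]]; last exact: TT.
  have Dx : op_dom T x by rewrite domT; exists x'.
  split=> //; apply: (dense_inner_inj (ip := ip) dT) => z Tz.
  by rewrite -(TT x Dx z Tz) Tx.
have dT : densely_defined T.
  move=> O O0 /(dS O O0)[u [Ou Du]]; exists u; split=> //.
  by have [] := op_closure_sub Du.
split=> //; exists clS, dT; have TT x : op_dom T x -> adjoint_rel ip T x (T x).
  by move=> Tx; apply/adjoint_rel_closure/graphT.
have domT : op_dom T = op_dom (adjoint ip dT).
  apply/seteqP; split=> x; first by move=> Tx; exists (T x); exact: TT.
  by move=> [x' /adjoint_rel_closure/graphT[]].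
split=> // x Tx; apply: (dense_inner_inj (ip := ip) dT) => z Tz.
by rewrite -(TT x Tx z Tz); apply: adjointP => //; rewrite -domT.
Qed.

End Closure.
End InnerProduct.

(** * Characterization of essential selfadjointness *)

Theorem corollary4p15 (R : realType) (k : scalar_kind)
    (H : completeNormedModType (scalar_field R k)) (ip : inner_product H)
    (S : linop H) (clS : closable S) :
  essentially_selfadjoint ip S <->
  [/\ formally_adjoint ip S S,
      ortho_compl ip (op_ran S) = op_ker (op_closure clS) &
      Rset ip S = op_ran (op_closure clS)].
Proof.
rewrite (essentially_selfadjointE ip clS); set T := op_closure clS.
split=> [[_ graphT]|[Ssym kerT ranT]].
  split.
  - move=> x y Dx Dy; suff Sy : adjoint_rel ip S y (S y) by exact: Sy.
    by apply/graphT; exact: op_closure_sub.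
  - by apply/seteqP; split=> x; rewrite ortho_ranE graphT.
  - apply/seteqP; split=> x; rewrite Rset_adjointE.
      by move=> [y /graphT[Ty <-]]; exists y.
    by move=> [y Ty <-]; exists y; apply/graphT.
have T_adj x : op_dom T x -> adjoint_rel ip S x (T x).
  exact: adjoint_rel_symmetric.
have adj0 x : adjoint_rel ip S x 0 -> op_dom T x /\ T x = 0.
  by rewrite -ortho_ranE kerT.
have adj_ran x x' : adjoint_rel ip S x x' -> exists2 y, op_dom T y & T y = x'.
  by move=> Sx; have : Rset ip S x' by [apply/Rset_adjointE; exists x]; rewrite ranT.
split.
  apply: (dense_of_ortho (ip := ip)) => z Sz.
  have [|y Ty yz] := adj_ran 0 z.
    by move=> u Du; rewrite linear0r Sz.
  suff /adj0[_ <-] : adjoint_rel ip S y 0 by [].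
  by move=> u Du; rewrite (T_adj y Ty) // yz linear0r Sz.
move=> x x'; split=> [Sx|[Tx <-]]; last exact: T_adj.
have [y Ty Tyx'] := adj_ran _ _ Sx.
have /adj0[Txy Txy0] : adjoint_rel ip S (x - y) 0.
  have := adjoint_relD (-1) (T_adj y Ty) Sx.
  by rewrite Tyx' !scaleN1r addNr addrC.
have xE : x = 1 *: (x - y) + y by rewrite scale1r subrK.
split; rewrite xE; first exact: op_dom_linear.
by rewrite op_linear // Txy0 scaler0 add0r.
Qed.
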